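(* Let $\mathbf{ILX}$ be any logic extending $\mathbf{IL}$, let $\Gamma$ be an $\mathbf{ILX}$-MCS, $B$ a formula and $S$ a set of formulas. If for every finite $S'\subseteq S$ we have $\neg\big(B\rhd\bigvee_{\sigma\in S'}\neg\sigma\big)\in\Gamma$, then there exists an $\mathbf{ILX}$-MCS $\Delta$ such that $\Gamma\prec_S\Delta$ and $B,\Box\neg B\in\Delta$.
   Context: Formulas are built from $\bot$, propositional variables, $\to$, $\Box$ and binary $\rhd$; $\Diamond A:=\neg\Box\neg A$. $\mathbf{IL}$ is axiomatised by classical tautologies, K: $\Box(A\to B)\to(\Box A\to\Box B)$, L: $\Box(\Box A\to A)\to\Box A$, J1: $\Box(A\to B)\to A\rhd B$, J2: $(A\rhd B)\wedge(B\rhd C)\to A\rhd C$, J3: $(A\rhd C)\wedge(B\rhd C)\to A\vee B\rhd C$, J4: $A\rhd B\to(\Diamond A\to\Diamond B)$, J5: $\Diamond A\rhd A$, with modus ponens and necessitation. A logic extending $\mathbf{IL}$ is a superset of $\mathbf{IL}$ closed under these rules. An $\mathbf{ILX}$-MCS is a maximal $\mathbf{ILX}$-consistent set of formulas. For MCSs $\Gamma,\Delta$ and a set $S$: $\Gamma\prec_S\Delta$ iff for every formula $A$ and every finite $S'\subseteq S$, if $\neg A\rhd\bigvee_{\sigma\in S'}\neg\sigma\in\Gamma$ then $A,\Box A\in\Delta$ (empty disjunction is $\bot$). *)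

(* Defs.v *)
From Stdlib Require Import List Ensembles.

Inductive form : Type :=
| Bot : form
| Var : nat -> form
| Imp : form -> form -> form
| Box : form -> form
| Rhd : form -> form -> form.

Definition Neg (A : form) : form := Imp A Bot.
Definition Or (A B : form) : form := Imp (Neg A) B.
Definition And (A B : form) : form := Neg (Imp A (Neg B)).
Definition Dia (A : form) : form := Neg (Box (Neg A)).

Declare Scope form_scope.
Delimit Scope form_scope with form.
Bind Scope form_scope with form.

(* As usual for interpretability logics, the binary modality binds weaker than
   conjunction and disjunction but stronger than implication. *)
Notation "⊥" := Bot : form_scope.
Notation "¬ A" := (Neg A) (at level 75, right associativity) : form_scope.
Notation "□ A" := (Box A) (at level 75, right associativity) : form_scope.
Notation "◇ A" := (Dia A) (at level 75, right associativity) : form_scope.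
Notation "A ∧ B" := (And A B) (at level 80, right associativity) : form_scope.
Notation "A ∨ B" := (Or A B) (at level 85, right associativity) : form_scope.
Notation "A ▷ B" := (Rhd A B) (at level 88, no associativity) : form_scope.
Notation "A → B" := (Imp A B)
  (at level 99, B at level 200, right associativity) : form_scope.

Open Scope form_scope.

(* Finite sets of formulas are given by lists enumerating them. *)
Definition big_and (l : list form) : form := fold_right And (¬ ⊥) l.
Definition big_or (l : list form) : form := fold_right Or ⊥ l.

Definition finite_sub (l : list form) (S : Ensemble form) : Prop :=
  forall A, List.In A l -> Ensembles.In form S A.

(* Variables and formulas whose main connective is modal are the atoms of
   classical propositional reasoning; [v] gives their truth values. *)
Fixpoint eval (v : form -> bool) (A : form) : bool :=
  match A with
  | Bot => false
  | Imp B C => implb (eval v B) (eval v C)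
  | _ => v A
  end.

Definition tautology (A : form) : Prop := forall v, eval v A = true.

Inductive IL : Ensemble form :=
| IL_taut A : tautology A -> IL A
| IL_K A B : IL (□ (A → B) → (□ A → □ B))
| IL_L A : IL (□ (□ A → A) → □ A)
| IL_J1 A B : IL (□ (A → B) → A ▷ B)
| IL_J2 A B C : IL ((A ▷ B) ∧ (B ▷ C) → A ▷ C)
| IL_J3 A B C : IL ((A ▷ C) ∧ (B ▷ C) → A ∨ B ▷ C)
| IL_J4 A B : IL (A ▷ B → (◇ A → ◇ B))
| IL_J5 A : IL (◇ A ▷ A)
| IL_mp A B : IL (A → B) -> IL A -> IL B
| IL_nec A : IL A -> IL (□ A).

Record extends_IL (L : Ensemble form) : Prop := {
  extends_IL_incl : Included form IL L;
  extends_IL_mp : forall A B,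
    Ensembles.In form L (A → B) -> Ensembles.In form L A ->
    Ensembles.In form L B;
  extends_IL_nec : forall A,
    Ensembles.In form L A -> Ensembles.In form L (□ A)
}.

Definition consistent (L Γ : Ensemble form) : Prop :=
  forall l, finite_sub l Γ -> ~ Ensembles.In form L (¬ big_and l).

Definition MCS (L Γ : Ensemble form) : Prop :=
  consistent L Γ /\
  forall Δ, consistent L Δ -> Included form Γ Δ -> Included form Δ Γ.

Definition assuring (S Γ Δ : Ensemble form) : Prop :=
  forall (A : form) (S' : list form),
    finite_sub S' S ->
    Ensembles.In form Γ (¬ A ▷ big_or (map Neg S')) ->
    Ensembles.In form Δ A /\ Ensembles.In form Δ (□ A).

Notation "Γ ≺[ S ] Δ" := (assuring S Γ Δ)
  (at level 70, no associativity) : type_scope.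

(* Main.v *)
Require Import Defs.
From Stdlib Require Import List Ensembles Classical Cantor Lia.

(** Let [D] be the set of formulas [A] with [¬ A ▷ ⋁ ¬ S'] in [Γ] for some
    finite [S'] included in [S].  By J3, [D] is closed under conjunction, so if
    [D], [□ D], [B], [□ ¬ B] were jointly inconsistent, a single [A] in [D]
    would give [B ∧ □ ¬ B → ¬ A ∨ ◇ ¬ A] in the logic.  Löb's axiom yields
    [B ▷ B ∧ □ ¬ B], and J5 yields [¬ A ∨ ◇ ¬ A ▷ ¬ A]; hence
    [B ▷ ⋁ ¬ S'] would be in [Γ].  So the set is consistent, and [Δ] is
    obtained by Lindenbaum's lemma. *)

(** * Finite subsets, given as lists *)

Lemma finite_sub_app (l1 l2 : list form) (T : Ensemble form) :
  finite_sub l1 T -> finite_sub l2 T -> finite_sub (l1 ++ l2) T.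
Proof. intros H1 H2 A HA. apply in_app_or in HA as [HA | HA]; auto. Qed.

Lemma finite_sub_cons (A : form) (l : list form) (T : Ensemble form) :
  T A -> finite_sub l T -> finite_sub (A :: l) T.
Proof. intros HA Hl C [<- | HC]; [exact HA | exact (Hl C HC)]. Qed.

Lemma finite_sub_nil (T : Ensemble form) : finite_sub nil T.
Proof. intros A []. Qed.

Lemma finite_sub_incl (l : list form) (T U : Ensemble form) :
  Included form T U -> finite_sub l T -> finite_sub l U.
Proof. intros HTU Hl A HA. exact (HTU A (Hl A HA)). Qed.

(** * Lindenbaum's lemma *)

Fixpoint form_code (A : form) : nat :=
  match A with
  | Bot => to_nat (0, 0)
  | Var n => to_nat (1, n)
  | Imp B C => to_nat (2, to_nat (form_code B, form_code C))
  | Box B => to_nat (3, form_code B)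
  | Rhd B C => to_nat (4, to_nat (form_code B, form_code C))
  end.

Lemma form_code_inj (A B : form) : form_code A = form_code B -> A = B.
Proof.
  revert B; induction A; intros B' H; destruct B'; cbn [form_code] in H;
    apply to_nat_inj in H; apply pair_equal_spec in H as [H0 H];
    try discriminate H0;
    try (apply to_nat_inj, pair_equal_spec in H as [H H']);
    try reflexivity; f_equal; auto.
Qed.

Lemma consistent_incl (L T U : Ensemble form) :
  Included form T U -> consistent L U -> consistent L T.
Proof. intros HTU HU l Hl. exact (HU l (finite_sub_incl l T U HTU Hl)). Qed.

(** Stage [S n] treats the formula with code [n], if there is one. The choice whether to add it sits
    inside the predicate, as consistency cannot be tested by computation. *)
Fixpoint lindenbaum_stage (L T : Ensemble form) (n : nat) : Ensemble form :=
  match n with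
  | 0 => T
  | S n => fun A =>
      lindenbaum_stage L T n A \/
      (form_code A = n /\
       consistent L (fun C => lindenbaum_stage L T n C \/ C = A))
  end.

Lemma lindenbaum_stage_le (L T : Ensemble form) (m n : nat) :
  m <= n ->
  Included form (lindenbaum_stage L T m) (lindenbaum_stage L T n).
Proof. induction 1 as [| n _ IH]; intros A HA; [exact HA | left; exact (IH A HA)]. Qed.

Lemma lindenbaum_stage_consistent (L T : Ensemble form) (n : nat) :
  consistent L T -> consistent L (lindenbaum_stage L T n).
Proof.
  intros HT; induction n as [| n IH]; [exact HT |].
  destruct (classic (exists A, form_code A = n /\
    consistent L (fun C => lindenbaum_stage L T n C \/ C = A)))
    as [[A [HA HcA]] | Hno].
  (* Codes are injective, so [A] is the only formula this stage can add. *)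
  - apply consistent_incl with (2 := HcA); intros C [HC | [HC _]].
    + left; exact HC.
    + right; apply form_code_inj; congruence.
  - apply consistent_incl with (2 := IH); intros C [HC | HC].
    + exact HC.
    + contradict Hno; exists C; exact HC.
Qed.

(** The stages increase, so the largest index needed for a member of [l] serves for all of them. *)
Lemma finite_sub_lindenbaum_stage (L T : Ensemble form) (l : list form) :
  finite_sub l (fun A => exists n, lindenbaum_stage L T n A) ->
  exists n, finite_sub l (lindenbaum_stage L T n).
Proof.
  induction l as [| A l IH]; intros Hl.
  - exists 0; apply finite_sub_nil.
  - destruct IH as [m Hm]; [intros C HC; apply Hl; right; exact HC |].
    destruct (Hl A (or_introl eq_refl)) as [n Hn].
    exists (max m n); apply finite_sub_cons.
    + apply lindenbaum_stage_le with (2 := Hn); lia.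
    + apply finite_sub_incl with (2 := Hm), lindenbaum_stage_le; lia.
Qed.

Lemma lindenbaum (L T : Ensemble form) :
  consistent L T -> exists U, MCS L U /\ Included form T U.
Proof.
  intros HT; exists (fun A => exists n, lindenbaum_stage L T n A).
  split; [split |].
  - intros l Hl; destruct (finite_sub_lindenbaum_stage L T l Hl) as [n Hn].
    exact (lindenbaum_stage_consistent L T n HT l Hn).
  (* The set tested when [A] has its turn lies inside the consistent [V], so [A] was added. *)
  - intros V HV HUV A HA; exists (S (form_code A)); right; split; [reflexivity |].
    apply consistent_incl with (2 := HV); intros C [HC | ->].
    + apply HUV; exists (form_code A); exact HC.
    + exact HA.
  - intros A HA; exists 0; exact HA.
Qed.

(** * Propositional and modal reasoning in extensions of IL *)

Lemma eval_And (v : form -> bool) (A B : form) :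
  eval v (A ∧ B) = andb (eval v A) (eval v B).
Proof. simpl; destruct (eval v A), (eval v B); reflexivity. Qed.

Lemma eval_Or (v : form -> bool) (A B : form) :
  eval v (A ∨ B) = orb (eval v A) (eval v B).
Proof. simpl; destruct (eval v A), (eval v B); reflexivity. Qed.

Lemma eval_big_and_app (v : form -> bool) (l1 l2 : list form) :
  eval v (big_and (l1 ++ l2)) =
  andb (eval v (big_and l1)) (eval v (big_and l2)).
Proof.
  induction l1 as [| A l1 IH]; [reflexivity |].
  change (eval v (A ∧ big_and (l1 ++ l2)) =
    andb (eval v (A ∧ big_and l1)) (eval v (big_and l2))).
  rewrite !eval_And, IH; apply Bool.andb_assoc.
Qed.

Lemma eval_big_or_app (v : form -> bool) (l1 l2 : list form) :
  eval v (big_or (l1 ++ l2)) =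
  orb (eval v (big_or l1)) (eval v (big_or l2)).
Proof.
  induction l1 as [| A l1 IH]; [reflexivity |].
  change (eval v (A ∨ big_or (l1 ++ l2)) =
    orb (eval v (A ∨ big_or l1)) (eval v (big_or l2))).
  rewrite !eval_Or, IH; apply Bool.orb_assoc.
Qed.

(** A truth table over all subformulas on which [eval] is stuck: schematic formulas and modal
    atoms. *)
Ltac taut :=
  let v := fresh "v" in
  intros v; simpl; rewrite ?map_app, ?eval_big_and_app, ?eval_big_or_app;
  unfold big_and, big_or; simpl;
  repeat match goal with
  | |- context [eval v ?A] => destruct (eval v A); simpl
  | |- context [v ?A] => destruct (v A); simpl
  end; reflexivity.

Section Extension.

Variable L : Ensemble form.
Hypothesis hL : extends_IL L.

Lemma ext_taut (A : form) : tautology A -> L A.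
Proof. intros H; apply (extends_IL_incl L hL), IL_taut, H. Qed.

Lemma ext_mp (A B : form) : L (A → B) -> L A -> L B.
Proof. apply (extends_IL_mp L hL). Qed.

Lemma ext_taut1 (A B : form) : L A -> tautology (A → B) -> L B.
Proof. intros HA HT; exact (ext_mp _ _ (ext_taut _ HT) HA). Qed.

Lemma ext_taut2 (A B C : form) : L A -> L B -> tautology (A → B → C) -> L C.
Proof. intros HA HB HT; exact (ext_mp _ _ (ext_taut1 _ _ HA HT) HB). Qed.

Lemma ext_box_mono (A B : form) : L (A → B) -> L (□ A → □ B).
Proof.
  intros H; apply ext_mp with (□ (A → B)).
  - apply (extends_IL_incl L hL), IL_K.
  - apply (extends_IL_nec L hL), H.
Qed.

(** Since [¬ X] amounts to [□ ¬ B → ¬ B], Löb's axiom turns [□ ¬ X] into [□ ¬ B], which together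
    with [B] is [X]. *)
Lemma ext_loeb_contra (B : form) :
  let X := B ∧ □ ¬ B in L (B → X ∨ ◇ X).
Proof.
  intros X.
  assert (H1 : L (□ ¬ X → □ (□ ¬ B → ¬ B)))
    by (apply ext_box_mono, ext_taut; unfold X; taut).
  assert (H2 : L (□ (□ ¬ B → ¬ B) → □ ¬ B))
    by (apply (extends_IL_incl L hL), IL_L).
  apply (ext_taut2 _ _ _ H1 H2); unfold X; taut.
Qed.

(** The occurrences of [A] that are not taken from [T] are dropped from the list and become one
    premise, as in the deduction theorem. *)
Lemma finite_sub_add (T : Ensemble form) (A : form) (l : list form) :
  finite_sub l (fun C => T C \/ C = A) ->
  exists l', finite_sub l' T /\ L (big_and l' → A → big_and l).
Proof.
  induction l as [| C l IH]; intros Hl.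
  - exists nil; split; [apply finite_sub_nil | apply ext_taut; taut].
  - destruct IH as [l' [Hl' HL]]; [intros D HD; apply Hl; right; exact HD |].
    destruct (Hl C (or_introl eq_refl)) as [HC | ->].
    + exists (C :: l'); split; [apply finite_sub_cons; assumption |].
      apply (ext_taut1 _ _ HL); taut.
    + exists l'; split; [exact Hl' |].
      apply (ext_taut1 _ _ HL); taut.
Qed.

(** * Deduction and interpretability inside a maximal consistent set *)

Section MaximalConsistent.

Variable Γ : Ensemble form.
Hypothesis hΓ : MCS L Γ.

(** By maximality it is enough that adding [A] keeps [Γ] consistent. Otherwise some [l'] from [Γ]
    refutes [A], and [l ++ l'] is an inconsistent part of [Γ]. *)
Lemma MCS_closed (l : list form) (A : form) :
  finite_sub l Γ -> L (big_and l → A) -> Γ A.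
Proof.
  intros Hl HA.
  apply (proj2 hΓ (fun C => Γ C \/ C = A)); [| left; assumption | right; reflexivity].
  intros m Hm Hincons.
  destruct (finite_sub_add Γ A m Hm) as [l' [Hl' HL]].
  apply (proj1 hΓ (l ++ l') (finite_sub_app _ _ _ Hl Hl')).
  apply (ext_mp (¬ big_and m)); [| exact Hincons].
  apply (ext_taut2 _ _ _ HA HL); taut.
Qed.

Lemma MCS_ext (A : form) : L A -> Γ A.
Proof.
  intros HA; apply (MCS_closed nil); [apply finite_sub_nil |].
  apply (ext_taut1 _ _ HA); taut.
Qed.

Lemma MCS_mp (A B : form) : Γ (A → B) -> Γ A -> Γ B.
Proof.
  intros HAB HA; apply (MCS_closed ((A → B) :: A :: nil)).
  - repeat apply finite_sub_cons; auto using finite_sub_nil.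
  - apply ext_taut; taut.
Qed.

Lemma MCS_and (A B : form) : Γ A -> Γ B -> Γ (A ∧ B).
Proof.
  intros HA HB; apply (MCS_mp B); [apply (MCS_mp A) |]; auto.
  apply MCS_ext, ext_taut; taut.
Qed.

Lemma MCS_not_both (A : form) : Γ A -> Γ (¬ A) -> False.
Proof.
  intros HA HnA; apply (proj1 hΓ (A :: (¬ A) :: nil)).
  - repeat apply finite_sub_cons; auto using finite_sub_nil.
  - apply ext_taut; taut.
Qed.

Lemma MCS_rhd_imp (A B : form) : L (A → B) -> Γ (A ▷ B).
Proof.
  intros H; apply MCS_ext, ext_mp with (□ (A → B)).
  - apply (extends_IL_incl L hL), IL_J1.
  - apply (extends_IL_nec L hL), H.
Qed.

Lemma MCS_rhd_trans (A B C : form) : Γ (A ▷ B) -> Γ (B ▷ C) -> Γ (A ▷ C).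
Proof.
  intros HAB HBC; apply (MCS_mp ((A ▷ B) ∧ (B ▷ C))); [| apply MCS_and; assumption].
  apply MCS_ext, (extends_IL_incl L hL), IL_J2.
Qed.

Lemma MCS_rhd_or (A B C : form) : Γ (A ▷ C) -> Γ (B ▷ C) -> Γ (A ∨ B ▷ C).
Proof.
  intros HA HB; apply (MCS_mp ((A ▷ C) ∧ (B ▷ C))); [| apply MCS_and; assumption].
  apply MCS_ext, (extends_IL_incl L hL), IL_J3.
Qed.

Lemma MCS_rhd_or_dia (A : form) : Γ (A ∨ ◇ A ▷ A).
Proof.
  apply MCS_rhd_or.
  - apply MCS_rhd_imp, ext_taut; taut.
  - apply MCS_ext, (extends_IL_incl L hL), IL_J5.
Qed.

Lemma MCS_rhd_loeb (B : form) : Γ (B ▷ B ∧ □ ¬ B).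
Proof.
  apply (MCS_rhd_trans _ _ _ (MCS_rhd_imp _ _ (ext_loeb_contra B))).
  apply MCS_rhd_or_dia.
Qed.

(** * The base of the successor and its consistency *)

Definition assured (S : Ensemble form) : Ensemble form := fun A =>
  exists S', finite_sub S' S /\ Γ (¬ A ▷ big_or (map Neg S')).

Lemma assured_top (S : Ensemble form) : assured S (¬ ⊥).
Proof.
  exists nil; split; [apply finite_sub_nil |].
  apply MCS_rhd_imp, ext_taut; taut.
Qed.

(** [¬ (A ∧ B)] yields [¬ A ∨ ¬ B]; each disjunct interprets the disjunction over the joined list,
    and J3 combines them. *)
Lemma assured_and (S : Ensemble form) (A B : form) :
  assured S A -> assured S B -> assured S (A ∧ B).
Proof.
  intros [SA [HSA HA]] [SB [HSB HB]].
  exists (SA ++ SB); split; [apply finite_sub_app; assumption |].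
  apply MCS_rhd_trans with (¬ A ∨ ¬ B); [apply MCS_rhd_imp, ext_taut; taut |].
  apply MCS_rhd_or; [apply (MCS_rhd_trans _ _ _ HA) | apply (MCS_rhd_trans _ _ _ HB)];
    apply MCS_rhd_imp, ext_taut; taut.
Qed.

(** The consequences of the assured formulas, their boxes, [B] and [□ ¬ B]. A single witness [A]
    suffices because assured formulas are closed under conjunction. *)
Definition successor_base (S : Ensemble form) (B : form) : Ensemble form := fun C =>
  exists A, assured S A /\ L (A → □ A → B → (□ ¬ B) → C).

Lemma successor_base_finite (S : Ensemble form) (B : form) (l : list form) :
  finite_sub l (successor_base S B) -> successor_base S B (big_and l).
Proof.
  induction l as [| C l IH]; intros Hl.
  - exists (¬ ⊥); split; [apply assured_top | apply ext_taut; taut].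
  - destruct IH as [A1 [HA1 HL1]]; [intros D HD; apply Hl; right; exact HD |].
    destruct (Hl C (or_introl eq_refl)) as [A2 [HA2 HL2]].
    exists (A1 ∧ A2); split; [apply assured_and; assumption |].
    assert (HB1 : L (□ (A1 ∧ A2) → □ A1)) by (apply ext_box_mono, ext_taut; taut).
    assert (HB2 : L (□ (A1 ∧ A2) → □ A2)) by (apply ext_box_mono, ext_taut; taut).
    apply (ext_mp _ _ (ext_mp _ _ (ext_taut2 _ _
      ((□ (A1 ∧ A2) → □ A1) → (□ (A1 ∧ A2) → □ A2) →
       (A1 ∧ A2 → □ (A1 ∧ A2) → B → (□ ¬ B) → big_and (C :: l)))
      HL1 HL2 ltac:(taut)) HB1) HB2).
Qed.

Lemma successor_base_consistent (S : Ensemble form) (B : form) :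
  (forall S', finite_sub S' S -> Γ (¬ (B ▷ big_or (map Neg S')))) ->
  consistent L (successor_base S B).
Proof.
  intros hB l Hl Hincons.
  destruct (successor_base_finite S B l Hl) as [A [[S' [HS' HA]] HL]].
  apply (MCS_not_both (B ▷ big_or (map Neg S'))); [| exact (hB S' HS')].
  (* The chain from [B] to the disjunction is built from both ends. What remains is the middle link
     [B ∧ □ ¬ B ▷ ¬ A ∨ ◇ ¬ A], which J1 derives from the inconsistency of [l]. *)
  apply (MCS_rhd_trans _ _ _ (MCS_rhd_loeb B)).
  apply MCS_rhd_trans with (2 := HA).
  apply MCS_rhd_trans with (2 := MCS_rhd_or_dia (¬ A)).
  (* [◇ ¬ A] unfolds to [¬ □ ¬ ¬ A], which is not propositionally [¬ □ A]. *)
  assert (HN : L (□ ¬ ¬ A → □ A)) by (apply ext_box_mono, ext_taut; taut).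
  apply MCS_rhd_imp, (ext_mp (¬ big_and l)); [| exact Hincons].
  apply (ext_taut2 _ _ _ HL HN); taut.
Qed.

End MaximalConsistent.

End Extension.

Theorem theorem5p2 (ILX : Ensemble form) (hILX : extends_IL ILX)
  (Γ : Ensemble form) (hΓ : MCS ILX Γ) (B : form) (S : Ensemble form)
  (hB : forall S' : list form, finite_sub S' S ->
    Ensembles.In form Γ (¬ (B ▷ big_or (map Neg S')))) :
  exists Δ : Ensemble form,
    MCS ILX Δ /\ Γ ≺[ S ] Δ /\
    Ensembles.In form Δ B /\ Ensembles.In form Δ (□ ¬ B).
Proof.
  destruct (lindenbaum _ _ (successor_base_consistent _ hILX Γ hΓ S B hB))
    as [Δ [HΔ Hsub]].
  exists Δ; split; [exact HΔ | split; [| split]].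
  (* Here [A] is assured and is its own witness, for [A] as well as for [□ A]. *)
  - intros A S' HS' HA; split; apply Hsub; exists A; split;
      try (exists S'; split; assumption); apply (ext_taut _ hILX); taut.
  (* [B] and [□ ¬ B] follow with any assured witness; [¬ ⊥] is one whatever [S] is. *)
  - apply Hsub; exists (¬ ⊥); split;
      [apply (assured_top _ hILX Γ hΓ) | apply (ext_taut _ hILX); taut].
  - apply Hsub; exists (¬ ⊥); split;
      [apply (assured_top _ hILX Γ hΓ) | apply (ext_taut _ hILX); taut].
Qed.
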